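(* Let $T$ be a compact metric space, let $\mu$ be a regular, nonatomic, $\sigma$-additive measure on the Borel $\sigma$-algebra $\mathcal{B}$ of $T$ with values in $[0,\infty)$, and let $X$ be a Banach lattice with order-continuous norm. Let $f,g:T\to X$ be two order-bounded maps (i.e. there is $M\in X$ with $|f(t)|\le M$ and $|g(t)|\le M$ for all $t\in T$) such that $f=g$ $\mu$-almost everywhere. Then $f$ is (oH)-integrable if and only if $g$ is (oH)-integrable, and in that case the two integrals coincide.
   Context: Let $d$ be the metric of $T$. A gage is any map $\gamma:T\to(0,\infty)$. A partition of $T$ is a finite family $\Pi=\{(E_i,t_i): i=1,\dots,k\}$, where the $E_i$ are pairwise disjoint Borel sets with union $T$ and $t_i\in T$ (the tags); it is a Henstock partition if $t_i\in E_i$ for all $i$. $\Pi$ is $\gamma$-fine if $d(w,t_i)<\gamma(t_i)$ for every $w\in E_i$ and every $i$. Put $\sigma(f,\Pi)=\sum_{i=1}^k f(t_i)\mu(E_i)$. An $(o)$-sequence in $X$ is a decreasing sequence $(b_n)_n$ with $\inf_n b_n=0$. A function $f:T\to X$ is (oH)-integrable if there exist $J\in X$, an $(o)$-sequence $(b_n)_n$ in $X$ and a sequence $(\gamma_n)_n$ of gages such that for every $n$ and every $\gamma_n$-fine Henstock partition $\Pi$ of $T$ one has $|\sigma(f,\Pi)-J|\le b_n$. Then $J$ is called the (oH)-integral of $f$. *)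

(* Defs.v *)
(* MathComp-Analysis. *)
From HB Require Import structures.
From mathcomp Require Import all_boot all_order all_algebra.
From mathcomp Require Import all_classical all_reals all_analysis.

Set Implicit Arguments.
Unset Strict Implicit.
Unset Printing Implicit Defensive.

Import Order.TTheory GRing.Theory Num.Theory.
Import numFieldNormedType.Exports.

Local Open Scope classical_set_scope.
Local Open Scope ring_scope.

(* The library's measurable types are pointed, so a metric space carrying a
   measure is taken to be nonempty. *)
#[short(type="pmetricType")]
HB.structure Definition PointedMetric (K : numDomainType) :=
  {M of Metric K M & Pointed M}.

(* Banach lattices.  The library's order structures cannot be joined with
   [normedModType] (the join would have to precede [numDomainType] in the
   hierarchy), so the order [ble] and the binary suprema [bjoin] are part of the
   mixin; binary infima are [- bjoin (- x) (- y)].  In [bler_norm] the bars are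
   the norm, and the lattice modulus |x| is [bjoin x (- x)], named [labs]
   below. *)
HB.mixin Record isBanachLattice (R : realType) X & CompleteNormedModule R X := {
  ble : rel X ;
  bjoin : X -> X -> X ;
  blexx : reflexive ble ;
  ble_anti : antisymmetric ble ;
  ble_trans : transitive ble ;
  blerD2r : forall x y z : X, ble x y -> ble (x + z) (y + z) ;
  bler_scale : forall (a : R) (x y : X), 0 <= a -> ble x y ->
    ble (a *: x) (a *: y) ;
  bleUx : forall x y z : X, ble (bjoin x y) z = ble x z && ble y z ;
  bler_norm : forall x y : X,
    ble (bjoin x (- x)) (bjoin y (- y)) -> `|x| <= `|y|
}.

#[short(type="banachLatticeType")]
HB.structure Definition BanachLattice (R : realType) :=
  {X of CompleteNormedModule R X & isBanachLattice R X}.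

Notation "x ⊑ y" := (ble x y) (at level 70, no associativity).

Definition labs (R : realType) (X : banachLatticeType R) (x : X) : X :=
  bjoin x (- x).

Definition is_glb (R : realType) (X : banachLatticeType R) (A : set X) (z : X) :=
  (forall x, A x -> z ⊑ x) /\ (forall y, (forall x, A x -> y ⊑ x) -> y ⊑ z).

(* Every decreasing net with infimum 0 converges to 0 in norm. *)
Definition order_continuous_norm (R : realType) (X : banachLatticeType R) :=
  forall (d : Order.disp_t) (I : preorderType d) (i0 : I) (x : I -> X),
    (forall i j : I, exists k : I, (i <= k)%O && (j <= k)%O) ->
    (forall i j : I, (i <= j)%O -> x j ⊑ x i) ->
    is_glb (range x) 0 ->
  forall e : R, 0 < e -> exists i, forall j, (i <= j)%O -> `|x j| < e.

Definition o_sequence (R : realType) (X : banachLatticeType R) (b : nat -> X) :=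
  (forall m n : nat, (m <= n)%N -> b n ⊑ b m) /\ is_glb (range b) 0.

Definition order_bounded_by (R : realType) (X : banachLatticeType R)
    (T : Type) (M : X) (f : T -> X) :=
  forall t, labs (f t) ⊑ M.

Definition borel (T : ptopologicalType) := g_sigma_algebraType (@open T).

Definition regular_measure (R : realType) (T : ptopologicalType)
    (mu : {finite_measure set (borel T) -> \bar R}) :=
  forall A : set T, open.-sigma.-measurable A ->
    mu A = ereal_sup [set mu K | K in [set K : set T | compact K /\ K `<=` A]]
    /\ mu A = ereal_inf [set mu U | U in [set U : set T | open U /\ A `<=` U]].

Definition atom (d : measure_display) (T : measurableType d) (R : realType)
    (mu : {finite_measure set T -> \bar R}) (A : set T) :=
  [/\ measurable A, (0 < mu A)%E &
    forall B, measurable B -> B `<=` A -> mu B = 0%E \/ mu B = mu A].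

Definition nonatomic (d : measure_display) (T : measurableType d)
    (R : realType) (mu : {finite_measure set T -> \bar R}) :=
  forall A, ~ atom mu A.

Definition gage (R : realType) (T : Type) (gamma : T -> R) :=
  forall t, 0 < gamma t.

Record tagged_partition (T : ptopologicalType) := TaggedPartition {
  tp_size : nat ;
  tp_set : 'I_tp_size -> set T ;
  tp_tag : 'I_tp_size -> T ;
  tp_measurable : forall i, open.-sigma.-measurable (tp_set i) ;
  tp_disjoint : trivIset setT tp_set ;
  tp_cover : \bigcup_i tp_set i = setT
}.
Arguments tp_set {T} P i : rename.
Arguments tp_tag {T} P i : rename.

Definition henstock (T : ptopologicalType) (P : tagged_partition T) :=
  forall i, tp_set P i (tp_tag P i).

Definition gage_fine (R : realType) (T : pmetricType R) (gamma : T -> R)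
    (P : tagged_partition T) :=
  forall i w, tp_set P i w -> mdist w (tp_tag P i) < gamma (tp_tag P i).

(* [fine] maps the finite extended real [mu E] to the corresponding real. *)
Definition riemann_sum (R : realType) (T : ptopologicalType)
    (X : banachLatticeType R) (mu : {finite_measure set (borel T) -> \bar R})
    (f : T -> X) (P : tagged_partition T) : X :=
  \sum_(i < tp_size P) fine (mu (tp_set P i)) *: f (tp_tag P i).

Definition is_oH_integral (R : realType) (T : pmetricType R)
    (X : banachLatticeType R) (mu : {finite_measure set (borel T) -> \bar R})
    (f : T -> X) (J : X) :=
  exists (b : nat -> X) (gamma : nat -> T -> R),
    [/\ o_sequence b, forall n, gage (gamma n) &
      forall n (P : tagged_partition T),
        henstock P -> gage_fine (gamma n) P ->
        labs (riemann_sum mu f P - J) ⊑ b n].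

Definition oH_integrable (R : realType) (T : pmetricType R)
    (X : banachLatticeType R) (mu : {finite_measure set (borel T) -> \bar R})
    (f : T -> X) :=
  exists J, is_oH_integral mu f J.

(* Main.v *)
(** Outer regularity encloses the exceptional null set in open sets [U n] with
    [mu (U n) < 1/(n+1)].  If a gage at each exceptional tag is so small that
    the corresponding set of a fine partition stays inside [U n], the Riemann
    sums of [f] and [g] differ by at most [2M/(n+1)], an (o)-sequence because
    the norm is monotone.
    Hence every integral of [f] is one of [g]; uniqueness of the integral comes
    from the existence of fine Henstock partitions on a compact space. *)
Require Import Defs.
From mathcomp Require Import all_boot all_order all_algebra.
From mathcomp Require Import all_classical all_reals all_analysis.

Set Implicit Arguments.
Unset Strict Implicit.
Unset Printing Implicit Defensive.

Import Order.TTheory GRing.Theory Num.Theory.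
Import numFieldNormedType.Exports.

Local Open Scope classical_set_scope.
Local Open Scope ring_scope.

(** * Order arithmetic and (o)-sequences in a Banach lattice *)

Section banach_lattice.
Context {R : realType} {X : banachLatticeType R}.
Implicit Types (x y z w : X) (a c : R) (b : nat -> X).

Lemma ble_le_trans {x y z} : x ⊑ y -> y ⊑ z -> x ⊑ z.
Proof. exact: ble_trans. Qed.

Lemma bleD x y z w : x ⊑ y -> z ⊑ w -> x + z ⊑ y + w.
Proof.
move=> xy zw; apply: (ble_le_trans (blerD2r _ _ z xy)).
by rewrite ![y + _]addrC; exact: blerD2r.
Qed.

Lemma ble_sub0 x y : (x - y ⊑ 0) = (x ⊑ y).
Proof.
apply/idP/idP => [/blerD2r|/blerD2r] /=.
  by move=> /(_ y); rewrite subrK add0r.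
by move=> /(_ (- y)); rewrite subrr.
Qed.

Lemma ble0_sub x y : (0 ⊑ y - x) = (x ⊑ y).
Proof.
apply/idP/idP => [/blerD2r|/blerD2r] /=.
  by move=> /(_ x); rewrite subrK add0r.
by move=> /(_ (- x)); rewrite subrr.
Qed.

Lemma ble_sum (I : finType) (F G : I -> X) :
  (forall i, F i ⊑ G i) -> \sum_i F i ⊑ \sum_i G i.
Proof.
move=> FG; elim/big_ind2 : _ => //; first exact: blexx.
by move=> *; exact: bleD.
Qed.

Lemma ble_wpZ2l a c x : 0 ⊑ x -> a <= c -> a *: x ⊑ c *: x.
Proof.
move=> x0 ac; rewrite -ble0_sub -scalerBl -(scaler0 X (c - a)).
by apply: bler_scale; rewrite ?subr_ge0.
Qed.

Lemma labs_ble x y : (labs x ⊑ y) = (x ⊑ y) && (- x ⊑ y).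
Proof. exact: bleUx. Qed.

Lemma labsN x : labs (- x) = labs x.
Proof.
have le_labsN z : labs (- z) ⊑ labs z.
  by rewrite labs_ble opprK andbC -labs_ble blexx.
by apply: ble_anti; rewrite le_labsN -{1}(opprK x) le_labsN.
Qed.

(** Stated for the doubled bound because [M + M] is what dominates the difference of two functions
    bounded by [M]. *)
Lemma labs_bound_ge0 x y : labs x ⊑ y -> 0 ⊑ y + y.
Proof.
by rewrite labs_ble => /andP[xy Nxy]; rewrite -(subrr x); exact: bleD.
Qed.

Lemma labs_triangle x y z w : labs x ⊑ y -> labs z ⊑ w -> labs (x + z) ⊑ y + w.
Proof.
rewrite !labs_ble => /andP[xy Nxy] /andP[zw Nzw].
by rewrite opprD !bleD.
Qed.

Lemma is_glb_le0 b y : is_glb (range b) 0 -> (forall n, y ⊑ b n) -> y ⊑ 0.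
Proof. by move=> [_ glb] yb; apply: glb => _ [n _ <-]. Qed.

Lemma norm_ble x y : 0 ⊑ x -> x ⊑ y -> `|x| <= `|y|.
Proof.
move=> x0 xy; apply: bler_norm; rewrite bleUx.
have yy : y ⊑ bjoin y (- y).
  by have := blexx (bjoin y (- y)); rewrite bleUx => /andP[].
rewrite (ble_le_trans xy yy)/=; apply: ble_le_trans yy.
apply: ble_le_trans (ble_le_trans x0 xy).
by rewrite -ble0_sub sub0r opprK.
Qed.

(** The Archimedean property of the order, drawn from the norm: the positive part [p] of a lower
    bound has norm at most [|x| / (n + 1)] for all [n], hence vanishes. *)
Lemma o_sequence_harmonicZ x : 0 ⊑ x ->
  o_sequence (fun n => (n.+1%:R^-1 : R) *: x).
Proof.
move=> x0; have ge0 n : 0 ⊑ (n.+1%:R^-1 : R) *: x.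
  by rewrite -(scaler0 X n.+1%:R^-1); apply: bler_scale.
split=> [m n mn|].
  by apply: ble_wpZ2l => //; rewrite lef_pV2 ?posrE// ler_nat.
split=> [_ [n _ <-] //|y ylb].
pose p := bjoin y 0; have : p ⊑ p by exact: blexx.
rewrite {1}/p bleUx => /andP[yp p0].
suff -> : 0 = p :> X by [].
apply/esym/eqP; rewrite -normr_eq0 eq_le normr_ge0 andbT leNgt.
apply/negP => np.
have pn n : `|p| <= n.+1%:R^-1 * `|x|.
  rewrite (_ : _ * _ = `|(n.+1%:R^-1 : R) *: x|); last first.
    by rewrite normrZ ger0_norm.
  by apply: norm_ble => //; rewrite bleUx ge0 andbT; apply: ylb; exists n.
have /archi_boundP : 0 <= `|x| / `|p| by [].
set n := Num.bound _; rewrite ltr_pdivrMr// => xn.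
have := pn n; rewrite mulrC ler_pdivlMr// leNgt => /negP; apply.
by rewrite mulrC (lt_le_trans xn)// ler_wpM2r// ler_nat.
Qed.

Lemma o_sequenceD b (c : nat -> X) :
  o_sequence b -> o_sequence c -> o_sequence (fun n => b n + c n).
Proof.
move=> [bd bglb] [cd cglb]; split=> [m n mn|].
  by apply: bleD; [exact: bd|exact: cd].
split=> [_ [n _ <-]|y ylb].
  by rewrite -(addr0 0); apply: bleD; [apply: bglb.1|apply: cglb.1]; exists n.
apply: is_glb_le0 cglb _ => n.
rewrite -ble_sub0; apply: is_glb_le0 bglb _ => m.
(* Passing to [maxn m n] decouples the two indices, so that the infimum over [m] can be taken with
   [n] fixed, and then the one over [n]. *)
have /(blerD2r _ _ (- c n)) : y ⊑ b m + c n.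
  apply: (@ble_le_trans _ (b (maxn m n) + c (maxn m n))).
    by apply: ylb; exists (maxn m n).
  by apply: bleD; [apply: bd; exact: leq_maxl|apply: cd; exact: leq_maxr].
by rewrite addrK.
Qed.

End banach_lattice.

(** * Fine Henstock partitions of a compact metric space *)

Section partitions.
Context {R : realType} {T : pmetricType R}.

(** Sending each point to the first set that contains it makes a finite cover disjoint. Each step of
    the induction on [s] intersects with the complement of the head set; the value [size s] collects
    the points that no set contains. *)
Lemma measurable_find (B : T -> set T) (s : seq T) (n : nat) :
  (forall t, open.-sigma.-measurable (B t)) ->
  open.-sigma.-measurable [set x | find (fun t => `[< B t x >]) s = n].
Proof.
move=> mB; elim: s n => [|t s IH] [|n] /=.
- rewrite (_ : mkset _ = setT); first exact: (@measurableT _ (borel T)).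
  by apply/seteqP; split.
- rewrite (_ : mkset _ = set0); first exact: (@measurable0 _ (borel T)).
  by apply/seteqP; split.
- rewrite (_ : mkset _ = B t) //.
  by apply/seteqP; split => x /=; case: asboolP.
- rewrite (_ : mkset _ =
      ~` B t `&` [set x | find (fun t => `[< B t x >]) s = n]).
    apply: (@measurableI _ (borel T)) => //.
    exact: (@measurableC _ (borel T)).
  apply/seteqP; split => x /=; case: asboolP => [Bt|nB] //.
  - by case=> <-.
  - by case.
  - by case=> _ <-.
Qed.

(** A version of Cousin's lemma: finitely many balls of radius [gamma t] cover the space, and the
    centres of the subcover serve as tags. The care lies in cutting the balls into disjoint sets
    without taking a tag away from its own set. *)
Lemma exists_henstock_fine (gamma : T -> R) : compact [set: T] -> gage gamma ->
  exists P : tagged_partition T, henstock P /\ gage_fine gamma P.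
Proof.
move=> cT ggamma.
pose B t := (ball t (gamma t))°.
move: cT; rewrite compact_cover => /(_ T setT B).
case=> [t _|x _|D _ cov]; first exact: open_interior.
  by exists x => //; exact/nbhsx_ballx.
pose s := finmap.enum_fset D; have us : uniq s := finmap.fset_uniq D.
(* A tag belongs to its own set only; every other point belongs to the first
   ball that contains it. *)
pose C t := [set t] `|` (B t `\` [set` s]).
have closed_fin : forall A : set T, finite_set A -> closed A.
  by apply/accessible_finite_set_closed/hausdorff_accessible/metric_hausdorff.
have mclosed (A : set T) : closed A -> open.-sigma.-measurable A.
  move=> cA; rewrite -(setCK A); apply: (@measurableC _ (borel T)).
  by apply: sub_sigma_algebra; exact: closed_openC.
have mC t : open.-sigma.-measurable (C t).
  apply: (@measurableU _ (borel T)).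
    by apply: mclosed; apply: closed_fin; exact: finite_set1.
  apply: (@measurableD _ (borel T)); last first.
    by apply: mclosed; apply: closed_fin; exact: finite_seq.
  by apply: sub_sigma_algebra; exact: open_interior.
pose own x := find (fun t => `[< C t x >]) s.
pose E (i : 'I_(size s)) := [set x | own x = i].
pose tag (i : 'I_(size s)) := tnth (in_tuple s) i.
have hasC x : has (fun t => `[< C t x >]) s.
  apply/hasP; have [xs|xs] := boolP (x \in s).
    by exists x => //; apply/asboolP; left.
  have [t tD Bx] := cov x I.
  by exists t => //; apply/asboolP; right; split => //; exact/negP.
have own_lt x : (own x < size s)%N by rewrite -has_find.
have C_own x : C (tag (Ordinal (own_lt x))) x.
  by rewrite /tag (tnth_nth point)/=; exact/asboolP/(nth_find point (hasC x)).
have Etriv : trivIset setT E.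
  by move=> i j _ _ [x [/= xi xj]]; apply: ord_inj; rewrite -xi -xj.
have Ecov : \bigcup_i E i = setT.
  by apply/seteqP; split => // x _; exists (Ordinal (own_lt x)).
exists (@TaggedPartition T (size s) E tag
  (fun i => measurable_find s i mC) Etriv Ecov); split=> [i|i w] /=.
  (* A tag lies in [s], so only the singleton part of its owner's set can contain it; as [s] has no
     duplicates, equal tags have equal indices. *)
  have [/= eq_tag|[_ []]] := C_own (tag i); last exact: mem_tnth.
  have /tuple_uniqP inj_tag : uniq (in_tuple s) by [].
  exact/esym/(congr1 val (inj_tag _ _ eq_tag)).
move=> Eiw; have := C_own w.
rewrite (_ : Ordinal _ = i); last exact: val_inj.
case=> [-> |[/interior_subset]]; first by rewrite mdistxx.
by rewrite ballEmdist/= metric_sym.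
Qed.

(** * Riemann sums and integrals of functions equal almost everywhere *)

Context {X : banachLatticeType R}
  (mu : {finite_measure set (borel T) -> \bar R}).

(** Only tags where [f] and [g] differ contribute; their sets are disjoint and lie in [U], so their
    measures add up to at most [mu U]. The estimate is one-sided; exchanging [f] and [g] yields the
    bound on the modulus. *)
Lemma riemann_sum_sub_ble (f g : T -> X) (M : X) (U : set T)
    (P : tagged_partition T) :
  order_bounded_by M f -> order_bounded_by M g -> open.-sigma.-measurable U ->
  (forall i, f (tp_tag P i) != g (tp_tag P i) -> tp_set P i `<=` U) ->
  riemann_sum mu f P - riemann_sum mu g P ⊑ fine (mu U) *: (M + M).
Proof.
move=> fM gM mU PU; have mP := @tp_measurable T P.
have mufin (A : set T) : open.-sigma.-measurable A -> mu A \is a fin_num.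
  by move=> mA; exact: (fin_num_measure mu).
have M0 : 0 ⊑ M + M := labs_bound_ge0 (fM point).
pose B i := f (tp_tag P i) != g (tp_tag P i).
have sumB : \sum_(i | B i) fine (mu (tp_set P i)) <= fine (mu U).
  rewrite sum_fine; last by move=> i _; exact: mufin.
  have mUB : open.-sigma.-measurable (\big[setU/set0]_(i | B i) tp_set P i).
    exact: (@bigsetU_measurable _ (borel T)).
  rewrite -(@measure_bigsetU_ord _ _ _ mu)//; last exact: tp_disjoint.
  rewrite fine_le ?mufin// le_measure ?inE//.
  by elim/big_ind : _ => // A B' AU BU; rewrite subUset.
apply: ble_le_trans (ble_wpZ2l M0 sumB).
rewrite /riemann_sum -sumrB scaler_suml [X in _ ⊑ X]big_mkcond /=.
apply: ble_sum => i; rewrite -scalerBr.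
case: ifPn => [_|]; last first.
  by rewrite negbK => /eqP ->; rewrite subrr scaler0 blexx.
apply: bler_scale; first exact: fine_ge0.
have := fM (tp_tag P i); have := gM (tp_tag P i).
by rewrite !labs_ble => /andP[_ ?] /andP[? _]; exact: bleD.
Qed.

Lemma oH_integral_ae_eq (f g : T -> X) (M J : X) :
  regular_measure mu -> order_bounded_by M f -> order_bounded_by M g ->
  {ae mu, forall t, f t = g t} -> is_oH_integral mu f J -> is_oH_integral mu g J.
Proof.
move=> mu_reg fM gM [N [mN muN fgN]] [b [gamma [ob ggamma bJ]]].
have /choice[U UP] (n : nat) : exists U : set T,
    [/\ open U, N `<=` U & (mu U < (n.+1%:R^-1)%:E)%E].
  have : (mu N < (n.+1%:R^-1)%:E)%E by rewrite muN lte_fin invr_gt0.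
  by rewrite (mu_reg N mN).2 => /ereal_inf_lt[_ [U [oU NU] <-] muU]; exists U.
(* Choosing over pairs gives all gages at once. Outside [N] the radius is an arbitrary positive
   default, 1. *)
have /choice[eta etaP] (nt : nat * T) : exists e : R,
    0 < e /\ (N nt.2 -> ball nt.2 e `<=` U nt.1).
  case: nt => n t /=; have [oU NU _] := UP n.
  have [Nt|nNt] := pselect (N t); last by exists 1.
  have /nbhs_ballP[e e0 eU] : nbhs t (U n).
    by apply: open_nbhs_nbhs; split=> //; exact: NU.
  by exists e.
(* [b n] controls the sums of [f] around [J]; the second term pays for replacing [f] by [g] on the
   same partition. *)
exists (fun n => b n + n.+1%:R^-1 *: (M + M)),
  (fun n t => Num.min (gamma n t) (eta (n, t))).
have M0 : 0 ⊑ M + M := labs_bound_ge0 (fM point).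
split=> [|n t|n P hP fP]; first exact/o_sequenceD/o_sequence_harmonicZ.
  by rewrite lt_min ggamma (etaP (n, t)).1.
have [oU NU muU] := UP n.
have mU : open.-sigma.-measurable (U n) by exact: sub_sigma_algebra.
have PU i : f (tp_tag P i) != g (tp_tag P i) -> tp_set P i `<=` U n.
  move=> /eqP fg w Pw; apply: (etaP (n, tp_tag P i)).2; first exact: fgN.
  rewrite ballEmdist /= metric_sym.
  by have := fP i w Pw; rewrite lt_min => /andP[].
have PU' i : g (tp_tag P i) != f (tp_tag P i) -> tp_set P i `<=` U n.
  by rewrite eq_sym; exact: PU.
have muUn : fine (mu (U n)) <= n.+1%:R^-1.
  by rewrite -lee_fin fineK ?ltW//; exact: (fin_num_measure mu).
rewrite -(subrKA (riemann_sum mu f P)) addrC; apply: labs_triangle.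
  by apply: bJ => // i w Pw; have := fP i w Pw; rewrite lt_min => /andP[].
rewrite labs_ble opprB; apply/andP; split;
  by apply: ble_le_trans (ble_wpZ2l M0 muUn); exact: riemann_sum_sub_ble.
Qed.

(** One partition fine for the minimum of both gages compares [J] and [K] with the same Riemann sum,
    so [J - K] and its opposite lie below every term of the (o)-sequence [b n + c n]. *)
Lemma is_oH_integral_unique (f : T -> X) (J K : X) : compact [set: T] ->
  is_oH_integral mu f J -> is_oH_integral mu f K -> J = K.
Proof.
move=> cT [b [gamma [ob ggamma bJ]]] [c [delta [oc gdelta cK]]].
have JK n : labs (J - K) ⊑ b n + c n.
  have [|P [hP fP]] :=
      @exists_henstock_fine (fun t => Num.min (gamma n t) (delta n t)) cT.
    by move=> t; rewrite lt_min ggamma gdelta.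
  have fine_gamma : gage_fine (gamma n) P.
    by move=> i w /fP; rewrite lt_min => /andP[].
  have fine_delta : gage_fine (delta n) P.
    by move=> i w /fP; rewrite lt_min => /andP[].
  rewrite -(subrKA (riemann_sum mu f P)); apply: labs_triangle.
    by rewrite -labsN opprB; exact: bJ.
  exact: cK.
have [_ glb] := o_sequenceD ob oc.
apply: ble_anti; rewrite -ble_sub0 -[K ⊑ J]ble_sub0.
by apply/andP; split; apply: (is_glb_le0 glb) => n;
  have := JK n; rewrite labs_ble opprB => /andP[].
Qed.

End partitions.

Theorem proposition4 (R : realType) (T : pmetricType R)
    (T_compact : compact [set: T])
    (mu : {finite_measure set (borel T) -> \bar R})
    (mu_regular : regular_measure mu) (mu_nonatomic : nonatomic mu)
    (X : banachLatticeType R) (X_oc : order_continuous_norm X)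
    (f g : T -> X)
    (fg_bounded : exists M : X, order_bounded_by M f /\ order_bounded_by M g)
    (fg_ae : {ae mu, forall t, f t = g t}) :
  (oH_integrable mu f <-> oH_integrable mu g) /\
  (forall J K : X, is_oH_integral mu f J -> is_oH_integral mu g K -> J = K).
Proof.
have [M [fM gM]] := fg_bounded.
have gf_ae : {ae mu, forall t, g t = f t}.
  have [N [mN muN fgN]] := fg_ae.
  by exists N; split=> // t gft; apply: fgN => fgt; apply: gft.
split=> [|J K fJ gK].
  by split=> -[J intJ]; exists J;
    [apply: (oH_integral_ae_eq mu_regular fM gM)
    |apply: (oH_integral_ae_eq mu_regular gM fM)].
(* It remains to see that [J] is an integral of [g] as well. *)
apply: (is_oH_integral_unique T_compact) gK.
exact: (oH_integral_ae_eq mu_regular fM gM).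
Qed.
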